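(* The Sequential Algorithm given in the context (for solving Problem QRAP-NonSep-GBC using sequential breakpoint search) has a worst-case time complexity of $O(n\log n)$.
   Context: **Problem.** Let $\mathcal N=\{1,\dots,n\}$ be partitioned into disjoint subsets $\mathcal N_1,\dots,\mathcal N_m$ of sizes $n_1,\dots,n_m$, and let $\mathcal M=\{1,\dots,m\}$. Given $w,L,U\in\mathbb R^m$, $a\in\mathbb R^n_{>0}$, $b,l,u\in\mathbb R^n$, $R\in\mathbb R$, Problem QRAP-NonSep-GBC is $$\min_{x\in\mathbb R^n}\ \sum_{j=1}^m\tfrac12 w_j\Big(\sum_{i\in\mathcal N_j}x_i\Big)^2+\sum_{i=1}^n\big(\tfrac12a_ix_i^2+b_ix_i\big)$$ subject to $\sum_{i=1}^n x_i=R$; $L_j\le\sum_{i\in\mathcal N_j}x_i\le U_j$ for $j\in\mathcal M$; $l_i\le x_i\le u_i$ for $i\in\mathcal N$. Only instances with $1+w_j\sum_{i\in\mathcal N_j}1/a_i>0$ for every $j\in\mathcal M$ are considered (equivalently, strictly convex instances), and they are assumed feasible (Slater's condition). For $j\in\mathcal M$ and $S\in\mathbb R$, $\mathrm{QRAP}^j(S)$ is the problem of minimizing $\sum_{i\in\mathcal N_j}(\frac12a_ix_i^2+b_ix_i)$ subject to $\sum_{i\in\mathcal N_j}x_i=S$ and $l_i\le x_i\le u_i$ ($i\in\mathcal N_j$). Let $(\underline x_i)_{i\in\mathcal N_j}$ and $(\bar x_i)_{i\in\mathcal N_j}$ denote optimal solutions of $\mathrm{QRAP}^j(L_j)$ and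 $\mathrm{QRAP}^j(U_j)$; these subproblems are solved by a linear-time algorithm for simple quadratic resource allocation. After the replacement of bounds in Line 2 below, the constraints $L_j\le\sum_{i\in\mathcal N_j}x_i\le U_j$ are dropped, and $l,u$ denote the new bounds. **Notation.** For $\lambda\in\mathbb R$, $(x(\lambda),\mu(\lambda))$ is the solution of: $w_jy_j+a_ix_i+b_i+\lambda+\mu_i=0$ ($j\in\mathcal M$, $i\in\mathcal N_j$), $l_i\le x_i\le u_i$, $\max(0,\mu_i)(x_i-u_i)=0$, $\min(0,\mu_i)(x_i-l_i)=0$, where $y_j=\sum_{i\in\mathcal N_j}x_i$; $y_j(\lambda)=\sum_{i\in\mathcal N_j}x_i(\lambda)$. An optimal multiplier $\lambda^*$ is one with $\sum_ix_i(\lambda^* )=R$; then $x(\lambda^* )$ is the optimal solution. It is taken that for each $i$ there are unique breakpoints $\alpha_i<\beta_i$ with $\lambda\le\alpha_i\Leftrightarrow x_i(\lambda)=u_i$; $\alpha_i<\lambda<\beta_i\Leftrightarrow l_i<x_i(\lambda)<u_i$; $\beta_i\le\lambda\Leftrightarrow x_i(\lambda)=l_i$. Put $\mathcal N_j^{\rm lower}(\lambda)=\{i\in\mathcal N_j:\beta_i\le\lambda\}$, $\mathcal N_j^{\rm upper}(\lambda)=\{i\in\mathcal N_j:\alpha_i\ge\lambda\}$, $\mathcal N_j^{\rm free}(\lambda)=\{i\in\mathcal N_j:\alpha_i<\lambda<\beta_i\}$, and $$y_j^{\rm fixed}(\lambda)=\sum_{i\in\mathcal N_j^{\rm lower}(\lambda)}l_i+\sum_{i\in\mathcal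 N_j^{\rm upper}(\lambda)}u_i,\quad A_j(\lambda)=\sum_{i\in\mathcal N_j^{\rm free}(\lambda)}\frac1{a_i},\quad B_j(\lambda)=\sum_{i\in\mathcal N_j^{\rm free}(\lambda)}\frac{b_i}{a_i}.$$ ''Compute $x(\lambda)$'' means: $x_i(\lambda)=l_i$ on $\mathcal N_j^{\rm lower}(\lambda)$, $x_i(\lambda)=u_i$ on $\mathcal N_j^{\rm upper}(\lambda)$, and for $i\in\mathcal N_j^{\rm free}(\lambda)$ $$x_i(\lambda)=\frac1{a_i}\,\frac{-w_jy_j^{\rm fixed}(\lambda)-\lambda}{1+w_jA_j(\lambda)}-\frac{b_i}{a_i}+\frac{w_j}{a_i}\,\frac{B_j(\lambda)}{1+w_jA_j(\lambda)}.$$ **Breakpoint Procedure (for a given $j\in\mathcal M$).** 1. Compute the sets $\mathcal P_j=\{a_il_i+b_i: i\in\mathcal N_j\}$ and $\mathcal Q_j=\{a_iu_i+b_i: i\in\mathcal N_j\}$ (maintained as sorted lists). 2. Initialize $\bar Y:=\sum_{i\in\mathcal N_j}u_i$; $\bar A:=0$; $\bar B:=0$. 3. Repeat: 4. Take the smallest value $\eta_k:=\min(\mathcal P_j\cup\mathcal Q_j)$, $k$ being its index. 5. If $\eta_k\in\mathcal Q_j$ (breakpoint of type $\alpha_k$): 6. $y_j^{\rm fixed}(\alpha_k)=\bar Y$; $A_j(\alpha_k)=\bar A$; $B_j(\alpha_k)=\bar B$; 7. $\alpha_k:=w_j(B_j(\alpha_k)-y_j^{\rm fixed}(\alpha_k))-(a_ku_k+b_k)(1+w_jA_j(\alpha_k))$;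 8. $\bar Y=\bar Y-u_k$; $\bar A=\bar A+1/a_k$; $\bar B=\bar B+b_k/a_k$; 9. $\mathcal Q_j=\mathcal Q_j\setminus\{\eta_k\}$. 10. Else (breakpoint of type $\beta_k$): 11. $y_j^{\rm fixed}(\beta_k)=\bar Y$; $A_j(\beta_k)=\bar A$; $B_j(\beta_k)=\bar B$; 12. $\beta_k:=w_j(B_j(\beta_k)-y_j^{\rm fixed}(\beta_k))-(a_kl_k+b_k)(1+w_jA_j(\beta_k))$; 13. $\bar Y=\bar Y+l_k$; $\bar A=\bar A-1/a_k$; $\bar B=\bar B-b_k/a_k$; 14. $\mathcal P_j=\mathcal P_j\setminus\{\eta_k\}$. 15. End if. 16. Until $\mathcal P_j\cup\mathcal Q_j=\emptyset$. **Sequential Algorithm.** 1. For $j\in\mathcal M$: 2. Solve $\mathrm{QRAP}^j(L_j)$ and $\mathrm{QRAP}^j(U_j)$ and set $l_i:=\max(l_i,\underline x_i)$, $u_i:=\min(u_i,\bar x_i)$ for $i\in\mathcal N_j$. 3. Compute $\alpha_i,\beta_i$ for each $i\in\mathcal N_j$ using the Breakpoint Procedure. 4. End for. 5. $\mathcal B:=\{\alpha_i: i\in\mathcal N\}\cup\{\beta_i: i\in\mathcal N\}$ (maintained as a sorted list); $\tau:=0$; $\mathcal B^0:=\mathcal B$; $F:=\sum_{i=1}^nu_i$; $V:=0$. 6. For $j\in\mathcal M$: $\bar Y_j:=\sum_{i\in\mathcal N_j}u_i$; $\bar A_j:=0$; $\bar B_j:=0$. 7. While $\lambda^*$ has not been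 found yet: 8. Take the smallest value $\eta_k:=\min(\mathcal B^\tau)$ and $j$ with $k\in\mathcal N_j$. 9–11. For $j'\in\mathcal M$: $y_{j'}^{\rm fixed}(\eta_k)=\bar Y_{j'}$; $A_{j'}(\eta_k)=\bar A_{j'}$; $B_{j'}(\eta_k)=\bar B_{j'}$. 12. Compute $\sum_{j'=1}^my_{j'}(\eta_k)=F-V\eta_k$. 13–15. If $\sum_{j'}y_{j'}(\eta_k)=R$: $\lambda^*=\eta_k$; compute $x(\lambda^* )$ as $x(\eta_k)$; return. 16–18. Else if $\sum_{j'}y_{j'}(\eta_k)<R$: $\lambda^*=(F-R)/V$; compute $x(\lambda^* )$; return. 19. Else: 20–21. $F=F-\frac{\bar Y_j-\bar B_j}{1+w_j\bar A_j}$; $V=V-\frac{\bar A_j}{1+w_j\bar A_j}$. 22–25. If $\eta_k$ is the breakpoint $\alpha_k$: $\bar Y_j=\bar Y_j-u_k$; $\bar A_j=\bar A_j+1/a_k$; $\bar B_j=\bar B_j+b_k/a_k$. 26–30. Else: $\bar Y_j=\bar Y_j+l_k$; $\bar A_j=\bar A_j-1/a_k$; $\bar B_j=\bar B_j-b_k/a_k$. 31–32. $F=F+\frac{\bar Y_j-\bar B_j}{1+w_j\bar A_j}$; $V=V+\frac{\bar A_j}{1+w_j\bar A_j}$. 33–34. $\mathcal B^{\tau+1}:=\mathcal B^\tau\setminus\{\eta_k\}$; $\tau=\tau+1$. 35–36. End if; end while.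
   Formalization: Lines 9–11 of the Sequential Algorithm (the loop over j' in M in every iteration) are counted as constant-time recording by reference; executed literally they cost m steps each and O(n log n) fails, e.g. for m = n. If the breakpoints run out, the search stops without a result. *)

(* Defs.v *)
(* MathComp world; reals are an arbitrary [R : realType].

   The machine is a unit-cost real RAM.  A program of type [cost A] is its
   result paired with the number of elementary operations executed.  [ret] is
   free and only names values that are already available; every arithmetic
   operation, comparison, array access, list operation and loop test is charged
   one unit.  Arrays are modelled by functions; in the programs below they are
   used single-threadedly, except for short-lived aliases that are dead before
   the next write, so that a write is a constant-time operation. *)
From HB Require Import structures.
From mathcomp Require Import all_boot all_order all_algebra.
From mathcomp Require Import reals exp.

Set Implicit Arguments.
Unset Strict Implicit.
Unset Printing Implicit Defensive.

Import Order.TTheory GRing.Theory Num.Theory.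
Local Open Scope ring_scope.

Definition cost (A : Type) : Type := (A * nat)%type.
Definition result (A : Type) (c : cost A) : A := c.1.
Definition time (A : Type) (c : cost A) : nat := c.2.

Definition ret (A : Type) (x : A) : cost A := (x, 0%N).
Definition charge (A : Type) (k : nat) (x : A) : cost A := (x, k).
Definition tick (A : Type) (x : A) : cost A := charge 1 x.
Definition bind (A B : Type) (c : cost A) (f : A -> cost B) : cost B :=
  (result (f (result c)), (time c + time (f (result c)))%N).

Notation "'let!' p ':=' c 'in' d" := (bind c (fun p => d))
  (at level 200, p strict pattern, c at level 100, d at level 200,
   format "'let!'  p  ':='  c  'in' '//' d").

Definition lift2 (A B D : Type) (op : A -> B -> D)
    (x : cost A) (y : cost B) : cost D :=
  let! v := x in let! v' := y in tick (op v v').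

Declare Scope cost_scope.
Delimit Scope cost_scope with cost.
Notation "x + y" := (lift2 (fun v v' => v + v') x y) : cost_scope.
Notation "x - y" := (lift2 (fun v v' => v - v') x y) : cost_scope.
Notation "x * y" := (lift2 (fun v v' => v * v') x y) : cost_scope.
Notation "x / y" := (lift2 (fun v v' => v / v') x y) : cost_scope.
Notation "x <= y" := (lift2 (fun v v' => v <= v') x y) : cost_scope.
Notation "x < y" := (lift2 (fun v v' => v < v') x y) : cost_scope.
Notation "x == y" := (lift2 (fun v v' => v == v') x y) : cost_scope.
Notation cmax x y := (lift2 Num.max x y) (only parsing).
Notation cmin x y := (lift2 Num.min x y) (only parsing).

Section Arrays.
Variables (T : finType) (A : Type).

Definition new_array (v : A) : cost (T -> A) := charge #|T| (fun=> v).
Definition rd (f : T -> A) (i : T) : cost A := tick (f i).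
Definition wr (f : T -> A) (i : T) (v : cost A) : cost (T -> A) :=
  let! x := v in tick (fun k => if k == i then x else f k).
End Arrays.

Section ListPrograms.
Variables (T S : Type).

Fixpoint for_loop (s : seq T) (body : T -> S -> cost S) (z : S) : cost S :=
  if s is x :: s' then
    let! _ := tick tt in
    let! z' := body x z in
    for_loop s' body z'
  else tick z.

Fixpoint cmap (f : T -> cost S) (s : seq T) : cost (seq S) :=
  if s is x :: s' then
    let! y := f x in
    let! r := cmap f s' in
    tick (y :: r)
  else tick [::].
End ListPrograms.

Section MergeSort.
Variables (R : realType) (T : Type) (key : T -> R).

Fixpoint csplit (s : seq T) : cost (seq T * seq T) :=
  match s with
  | x :: y :: s' =>
      let! (s1, s2) := csplit s' in
      let! s1' := tick (x :: s1) in
      let! s2' := tick (y :: s2) in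
      tick (s1', s2')
  | _ => tick (s, [::])
  end.

Fixpoint cmerge (s1 : seq T) : seq T -> cost (seq T) :=
  if s1 is x1 :: s1' then
    fix merge_s1 (s2 : seq T) : cost (seq T) :=
      if s2 is x2 :: s2' then
        let! c := (tick (key x1) <= tick (key x2))%cost in
        if c then
          let! r := cmerge s1' s2 in tick (x1 :: r)
        else
          let! r := merge_s1 s2' in tick (x2 :: r)
      else tick s1
  else fun s2 => tick s2.

(* [d] only bounds the recursion depth; [csort] supplies enough of it. *)
Fixpoint csort_rec (d : nat) (s : seq T) : cost (seq T) :=
  match d, s with
  | d'.+1, _ :: _ :: _ =>
      let! (s1, s2) := csplit s in
      let! r1 := csort_rec d' s1 in
      let! r2 := csort_rec d' s2 in
      cmerge r1 r2
  | _, _ => tick s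
  end.

Definition csort (s : seq T) : cost (seq T) := csort_rec (size s) s.
End MergeSort.

Section SimpleQRAP.
Variable R : realType.

Definition qrap_feasible (n : nat) (s : seq 'I_n) (l u : 'I_n -> R) (S : R)
    (x : 'I_n -> R) : Prop :=
  \sum_(i <- s) x i = S /\ (forall i, i \in s -> l i <= x i <= u i).

Definition qrap_objective (n : nat) (s : seq 'I_n) (a b x : 'I_n -> R) : R :=
  \sum_(i <- s) (2^-1 * a i * x i ^+ 2 + b i * x i).

Definition qrap_optimal (n : nat) (s : seq 'I_n) (a b l u : 'I_n -> R) (S : R)
    (x : 'I_n -> R) : Prop :=
  qrap_feasible s l u S x /\
  forall x', qrap_feasible s l u S x' ->
    qrap_objective s a b x <= qrap_objective s a b x'.

Definition qrap_solver : Type :=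
  forall n : nat, seq 'I_n -> ('I_n -> R) -> ('I_n -> R) ->
    ('I_n -> R) -> ('I_n -> R) -> R -> cost ('I_n -> R).

Definition qrap_solver_correct (solve : qrap_solver) : Prop :=
  forall (n : nat) (s : seq 'I_n) (a b l u : 'I_n -> R) (S : R),
    uniq s -> (forall i, i \in s -> 0 < a i) ->
    (exists x, qrap_feasible s l u S x) ->
    qrap_optimal s a b l u S (result (solve n s a b l u S)).

Definition qrap_solver_linear_time (solve : qrap_solver) : Prop :=
  exists c : nat,
    forall (n : nat) (s : seq 'I_n) (a b l u : 'I_n -> R) (S : R),
      uniq s -> (forall i, i \in s -> 0 < a i) ->
      (exists x, qrap_feasible s l u S x) ->
      (time (solve n s a b l u S) <= c * (size s).+1)%N.
End SimpleQRAP.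

(* The partition is given by the map sending an index to its block. *)
Record instance (R : realType) (n m : nat) : Type := Instance {
  grp : 'I_n -> 'I_m;
  pw : 'I_m -> R;
  pL : 'I_m -> R;
  pU : 'I_m -> R;
  pa : 'I_n -> R;
  pb : 'I_n -> R;
  pl : 'I_n -> R;
  pu : 'I_n -> R;
  pR : R }.

Section Problem.
Variables (R : realType) (n m : nat) (I : instance R n m).

Definition block (j : 'I_m) : seq 'I_n := enum [pred i | grp I i == j].

Definition feasible (x : 'I_n -> R) : Prop :=
  [/\ \sum_i x i = pR I,
      forall j, pL I j <= \sum_(i <- block j) x i <= pU I j
    & forall i, pl I i <= x i <= pu I i].

(* The last two conditions express that the optimal solutions of the
   subproblems with right-hand sides L_j and U_j exist. *)
Record admissible : Prop := Admissible {
  adm_block : forall j, exists i, grp I i = j;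
  adm_a : forall i, 0 < pa I i;
  adm_convex : forall j, 0 < 1 + pw I j * \sum_(i <- block j) (pa I i)^-1;
  adm_feasible : exists x, feasible x;
  adm_L : forall j, exists x,
    qrap_feasible (block j) (pl I) (pu I) (pL I j) x;
  adm_U : forall j, exists x,
    qrap_feasible (block j) (pl I) (pu I) (pU I j) x }.

Definition kkt (l u : 'I_n -> R) (lambda : R) (x mu : 'I_n -> R) : Prop :=
  forall i,
    [/\ pw I (grp I i) * (\sum_(k <- block (grp I i)) x k)
          + pa I i * x i + pb I i + lambda + mu i = 0,
        l i <= x i <= u i,
        Num.max 0 (mu i) * (x i - u i) = 0
      & Num.min 0 (mu i) * (x i - l i) = 0].

Definition are_breakpoints (l u alpha beta : 'I_n -> R) : Prop :=
  exists x mu : R -> 'I_n -> R,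
    (forall lambda, kkt l u lambda (x lambda) (mu lambda)) /\
    forall i, alpha i < beta i /\
      forall lambda,
        [/\ lambda <= alpha i <-> x lambda i = u i,
            alpha i < lambda < beta i <-> l i < x lambda i < u i
          & beta i <= lambda <-> x lambda i = l i].
End Problem.

Section Algorithm.
Variables (R : realType) (solve : qrap_solver R).
Variables (n m : nat) (I : instance R n m).

Let narr := 'I_n -> R.
Let marr := 'I_m -> R.

Definition replace_bounds (j : 'I_m) (lu : narr * narr) : cost (narr * narr) :=
  let: (l, u) := lu in
  let! Lj := rd (pL I) j in
  let! xlow := solve (block I j) (pa I) (pb I) l u Lj in
  let! Uj := rd (pU I) j in
  let! xupp := solve (block I j) (pa I) (pb I) l u Uj in
  for_loop (block I j)
    (fun i lu =>
       let: (l, u) := lu in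
       let! l' := wr l i (cmax (rd l i) (rd xlow i)) in
       let! u' := wr u i (cmin (rd u i) (rd xupp i)) in
       ret (l', u'))
    (l, u).

Record bp_state := BpState {
  bp_alpha : narr; bp_beta : narr; bp_Y : R; bp_A : R; bp_B : R }.

Definition bp_step_alpha (u : narr) (j : 'I_m) (k : 'I_n) (st : bp_state) :
    cost bp_state :=
  let: BpState al be Y A B := st in
  let! Yfix := tick Y in
  let! Ak := tick A in
  let! Bk := tick B in
  let! al' := wr al k
    (rd (pw I) j * (ret Bk - ret Yfix)
     - (rd (pa I) k * rd u k + rd (pb I) k)
       * (ret 1 + rd (pw I) j * ret Ak))%cost in
  let! Y' := (ret Y - rd u k)%cost in
  let! A' := (ret A + ret 1 / rd (pa I) k)%cost in
  let! B' := (ret B + rd (pb I) k / rd (pa I) k)%cost in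
  ret (BpState al' be Y' A' B').

Definition bp_step_beta (l : narr) (j : 'I_m) (k : 'I_n) (st : bp_state) :
    cost bp_state :=
  let: BpState al be Y A B := st in
  let! Yfix := tick Y in
  let! Ak := tick A in
  let! Bk := tick B in
  let! be' := wr be k
    (rd (pw I) j * (ret Bk - ret Yfix)
     - (rd (pa I) k * rd l k + rd (pb I) k)
       * (ret 1 + rd (pw I) j * ret Ak))%cost in
  let! Y' := (ret Y + rd l k)%cost in
  let! A' := (ret A - ret 1 / rd (pa I) k)%cost in
  let! B' := (ret B - rd (pb I) k / rd (pa I) k)%cost in
  ret (BpState al be' Y' A' B').

(* The minimum of the two sorted lists is at one of the heads; when both heads
   attain it, it belongs to the second list, which then takes precedence.
   Pitfall: the keys are taken in increasing order although all variables start
   at their upper bounds, so that for pw I j != 0 the computed values need not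
   satisfy [are_breakpoints]. *)
Fixpoint bp_loop (l u : narr) (j : 'I_m) (P : seq (R * 'I_n)) :
    seq (R * 'I_n) -> bp_state -> cost bp_state :=
  fix bp_loop_P (Q : seq (R * 'I_n)) (st : bp_state) : cost bp_state :=
    let! _ := tick tt in
    match P, Q with
    | [::], [::] => ret st
    | [::], q :: Q' =>
        let! st' := bp_step_alpha u j q.2 st in bp_loop_P Q' st'
    | p :: P', [::] =>
        let! st' := bp_step_beta l j p.2 st in bp_loop l u j P' [::] st'
    | p :: P', q :: Q' =>
        let! c := (tick q.1 <= tick p.1)%cost in
        if c then
          let! st' := bp_step_alpha u j q.2 st in bp_loop_P Q' st'
        else
          let! st' := bp_step_beta l j p.2 st in bp_loop l u j P' Q st'
    end.

Definition block_sum (f : narr) (j : 'I_m) : cost R :=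
  for_loop (block I j) (fun i s => (ret s + rd f i)%cost) 0.

Definition bp_keys (f : narr) (j : 'I_m) : cost (seq (R * 'I_n)) :=
  let! s := cmap (fun i =>
      let! v := (rd (pa I) i * rd f i + rd (pb I) i)%cost in tick (v, i))
    (block I j) in
  csort fst s.

Definition breakpoint_procedure (l u : narr) (j : 'I_m) (ab : narr * narr) :
    cost (narr * narr) :=
  let: (al, be) := ab in
  let! P := bp_keys l j in
  let! Q := bp_keys u j in
  let! Y := block_sum u j in
  let! st := bp_loop l u j P Q (BpState al be Y 0 0) in
  ret (bp_alpha st, bp_beta st).

Record prepared := Prepared {
  new_l : narr; new_u : narr; alphas : narr; betas : narr }.

Definition preparation : cost prepared :=
  let! al := new_array _ 0 in
  let! be := new_array _ 0 in
  for_loop (enum 'I_m)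
    (fun j st =>
       let: Prepared l u al be := st in
       let! (l', u') := replace_bounds j (l, u) in
       let! (al', be') := breakpoint_procedure l' u' j (al, be) in
       ret (Prepared l' u' al' be'))
    (Prepared (pl I) (pu I) al be).

Record fixed_free := FixedFree { ff_Y : marr; ff_A : marr; ff_B : marr }.

Definition fixed_free_at (p : prepared) (lambda : R) : cost fixed_free :=
  let! Y := new_array _ 0 in
  let! A := new_array _ 0 in
  let! B := new_array _ 0 in
  for_loop (enum 'I_n)
    (fun i ff =>
       let: FixedFree Y A B := ff in
       let! j := rd (grp I) i in
       let! low := (rd (betas p) i <= ret lambda)%cost in
       if low then
         let! Y' := wr Y j (rd Y j + rd (new_l p) i)%cost in
         ret (FixedFree Y' A B)
       else
         let! upp := (ret lambda <= rd (alphas p) i)%cost in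
         if upp then
           let! Y' := wr Y j (rd Y j + rd (new_u p) i)%cost in
           ret (FixedFree Y' A B)
         else
           let! A' := wr A j (rd A j + ret 1 / rd (pa I) i)%cost in
           let! B' := wr B j (rd B j + rd (pb I) i / rd (pa I) i)%cost in
           ret (FixedFree Y A' B'))
    (FixedFree Y A B).

Definition compute_x (p : prepared) (ff : fixed_free) (lambda : R) :
    cost narr :=
  let: FixedFree Y A B := ff in
  let! x := new_array _ 0 in
  for_loop (enum 'I_n)
    (fun i x =>
       let! j := rd (grp I) i in
       let! low := (rd (betas p) i <= ret lambda)%cost in
       if low then wr x i (rd (new_l p) i)
       else
         let! upp := (ret lambda <= rd (alphas p) i)%cost in
         if upp then wr x i (rd (new_u p) i)
         else
           wr x i
             (ret 1 / rd (pa I) i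
                * (((ret 0 - rd (pw I) j) * rd Y j - ret lambda)
                     / (ret 1 + rd (pw I) j * rd A j))
              - rd (pb I) i / rd (pa I) i
              + rd (pw I) j / rd (pa I) i
                * (rd B j / (ret 1 + rd (pw I) j * rd A j)))%cost)
    x.

Record breakpoint := Breakpoint {
  bp_value : R; bp_index : 'I_n; bp_is_alpha : bool }.

Record search_state := SearchState {
  ss_F : R; ss_V : R; ss_Y : marr; ss_A : marr; ss_B : marr }.

Definition F_term (Y A B : marr) (j : 'I_m) : cost R :=
  ((rd Y j - rd B j) / (ret 1 + rd (pw I) j * rd A j))%cost.
Definition V_term (A : marr) (j : 'I_m) : cost R :=
  (rd A j / (ret 1 + rd (pw I) j * rd A j))%cost.

(* The outcome is [None] if the list of breakpoints is exhausted before a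
   multiplier has been found.  The values at the current breakpoint of all the
   block quantities are the current contents of the running arrays; they are
   recorded by reference, in constant time. *)
Fixpoint search (p : prepared) (bs : seq breakpoint) (st : search_state) :
    cost (option (R * narr)) :=
  let! _ := tick tt in
  if bs is Breakpoint eta k is_alpha :: bs' then
    let: SearchState F V Y A B := st in
    let! j := rd (grp I) k in
    let! Yfix := tick Y in
    let! Aeta := tick A in
    let! Beta := tick B in
    let! ysum := (ret F - ret V * ret eta)%cost in
    let! hit := (ret ysum == ret (pR I))%cost in
    if hit then
      let! x := compute_x p (FixedFree Yfix Aeta Beta) eta in
      ret (Some (eta, x))
    else
      let! passed := (ret ysum < ret (pR I))%cost in
      if passed then
        let! lambda := ((ret F - ret (pR I)) / ret V)%cost in
        let! ff := fixed_free_at p lambda in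
        let! x := compute_x p ff lambda in
        ret (Some (lambda, x))
      else
        let! F1 := (ret F - F_term Y A B j)%cost in
        let! V1 := (ret V - V_term A j)%cost in
        let! (Y', A', B') :=
          (if is_alpha then
             let! Y' := wr Y j (rd Y j - rd (new_u p) k)%cost in
             let! A' := wr A j (rd A j + ret 1 / rd (pa I) k)%cost in
             let! B' := wr B j (rd B j + rd (pb I) k / rd (pa I) k)%cost in
             ret (Y', A', B')
           else
             let! Y' := wr Y j (rd Y j + rd (new_l p) k)%cost in
             let! A' := wr A j (rd A j - ret 1 / rd (pa I) k)%cost in
             let! B' := wr B j (rd B j - rd (pb I) k / rd (pa I) k)%cost in
             ret (Y', A', B')) in
        let! F2 := (ret F1 + F_term Y' A' B' j)%cost in
        let! V2 := (ret V1 + V_term A' j)%cost in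
        search p bs' (SearchState F2 V2 Y' A' B')
  else ret None.

Definition all_breakpoints (p : prepared) : cost (seq breakpoint) :=
  let! bs := for_loop (enum 'I_n)
    (fun i bs =>
       let! al := rd (alphas p) i in
       let! bs1 := tick (Breakpoint al i true :: bs) in
       let! be := rd (betas p) i in
       tick (Breakpoint be i false :: bs1))
    [::] in
  csort bp_value bs.

Definition sequential_algorithm : cost (option (R * narr)) :=
  let! p := preparation in
  let! bs := all_breakpoints p in
  let! F := for_loop (enum 'I_n)
    (fun i s => (ret s + rd (new_u p) i)%cost) 0 in
  let! Y0 := new_array _ 0 in
  let! A := new_array _ 0 in
  let! B := new_array _ 0 in
  let! Y := for_loop (enum 'I_m)
    (fun j Y => wr Y j (block_sum (new_u p) j)) Y0 in
  search p bs (SearchState F 0 Y A B).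
End Algorithm.

(* Main.v *)
(* Running time.  The blocks are nonempty and partition the n indices, so m <= n
   and everything that is linear in the block sizes sums to O(n); what remains is
   the merge sort of the keys of each block and of the 2n breakpoints, and the
   search, whose iterations take constant time except for the last one.

   Search.  At the last breakpoint in sorted order, which is beta_k for some k,
   every variable except x_k has already been moved to its lower bound in the
   running sums.  There x is equal to the lower bounds, which sum to
   sum_j L_j <= R, and the multiplier mu_k is nonpositive because l_k < u_k.
   Stationarity then bounds the value computed for sum_j y_j by sum_j L_j: one of
   the two exits of the loop has to be taken, and no continuity of x is needed. *)
Require Import Defs.
From HB Require Import structures.
From mathcomp Require Import all_boot all_order all_algebra.
From mathcomp Require Import reals exp.
From mathcomp Require Import zify ring lra.

Import Order.TTheory GRing.Theory Num.Theory.
Local Open Scope ring_scope.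

Set Implicit Arguments.
Unset Strict Implicit.
Unset Printing Implicit Defensive.

(** * Cost of the loop combinators *)

Lemma time_bind (A B : Type) (c : cost A) (f : A -> cost B) :
  time (bind c f) = (time c + time (f (result c)))%N.
Proof. by []. Qed.

(** The invariant sees the elements still to be processed, so it can separate treated indices from
    untouched ones. The cost bound depends on the element, since a pass over a block costs more for
    a larger block. *)
Lemma for_loop_inv (T S : Type) (Inv : seq T -> S -> Prop) (c : T -> nat)
    (body : T -> S -> cost S) (s : seq T) (z : S) :
    (forall x s z, Inv (x :: s) z ->
       Inv s (result (body x z)) /\ (time (body x z) <= c x)%N) ->
    Inv s z ->
  Inv [::] (result (for_loop s body z)) /\
  (time (for_loop s body z) <= \sum_(x <- s) (c x).+1 + 1)%N.
Proof.
move=> step; elim: s z => [|x s IH] z Iz; first by rewrite big_nil.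
have [Iz' le_c] := step _ _ _ Iz; have [Ir le_t] := IH _ Iz'.
by split=> //; rewrite big_cons /=; lia.
Qed.

Lemma time_for_loop_le (T S : Type) (c : T -> nat) (body : T -> S -> cost S)
    (s : seq T) (z : S) :
  (forall x z, time (body x z) <= c x)%N ->
  (time (for_loop s body z) <= \sum_(x <- s) (c x).+1 + 1)%N.
Proof.
by move=> le_c; case: (@for_loop_inv T S (fun _ _ => True) c body s z).
Qed.

Lemma time_for_loop_const (T S : Type) (c : nat) (body : T -> S -> cost S)
    (s : seq T) (z : S) :
  (forall x z, time (body x z) <= c)%N ->
  (time (for_loop s body z) <= c.+1 * size s + 1)%N.
Proof.
move=> le_c; apply: leq_trans (time_for_loop_le s z le_c) _.
by rewrite big_const_seq count_predT iter_addn_0.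
Qed.

Lemma time_for_loop_ord (n : nat) (S : Type) (c : nat)
    (body : 'I_n -> S -> cost S) (z : S) :
  (forall i z, time (body i z) <= c)%N ->
  (time (for_loop (enum 'I_n) body z) <= c.+1 * n + 1)%N.
Proof.
move=> le_c; rewrite -[X in (_ <= _ * X + _)%N]size_enum_ord.
exact: time_for_loop_const.
Qed.

Lemma time_cmap (T S : Type) (c : nat) (f : T -> cost S) (s : seq T) :
  (forall x, time (f x) = c) -> time (cmap f s) = (c.+1 * size s + 1)%N.
Proof.
move=> time_f; elim: s => [|x s IH] /=; first by lia.
by rewrite IH time_f; lia.
Qed.

Lemma size_cmap (T S : Type) (f : T -> cost S) (s : seq T) :
  size (result (cmap f s)) = size s.
Proof. by elim: s => //= x s ->. Qed.

(** * Merge sort: correctness and running time *)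

Section MergeSort.
Variables (R : realType) (T : eqType) (key : T -> R).
Implicit Types s : seq T.

Lemma csplit_spec s (r := csplit s) :
  [/\ perm_eq ((result r).1 ++ (result r).2) s,
      size (result r).1 = uphalf (size s), size (result r).2 = (size s)./2
    & (time r <= 2 * size s + 1)%N].
Proof.
rewrite {}/r; have [N] := ubnP (size s).
elim: N s => // N IH [|x [|y s]] //= leN.
have /IH[] : (size s < N)%N by lia.
rewrite [csplit s]surjective_pairing /bind /time /result /=.
case: (csplit s) => [[s1 s2] t] /= perm12 -> -> ?.
split=> //; last by lia.
by rewrite /= perm_cons perm_catC /= perm_cons perm_catC.
Qed.

Lemma result_cmerge s1 s2 :
  result (cmerge key s1 s2) = merge (relpre key <=%R) s1 s2.
Proof.
elim: s1 s2 => [|x1 s1 IH1] //; elim=> [|x2 s2 IH2] //=.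
by case: ifP => _ /=; [rewrite IH1 | move: IH2 => /= ->].
Qed.

Lemma time_cmerge s1 s2 :
  (time (cmerge key s1 s2) <= 4 * (size s1 + size s2) + 1)%N.
Proof.
elim: s1 s2 => [|x1 s1 IH1] //; elim=> [|x2 s2 IH2] //=.
case: ifP => _ /=.
  by have /= := IH1 (x2 :: s2); lia.
by move: IH2; rewrite /=; lia.
Qed.

Lemma perm_csort_rec d s : perm_eq (result (csort_rec key d s)) s.
Proof.
elim: d s => [|d IH] [|x [|y s]] //=.
have [/= + _ _ _] := csplit_spec [:: x, y & s].
case: (result _) => s1 s2 /= /permPr <-.
by rewrite result_cmerge perm_merge perm_cat.
Qed.

Lemma csort_rec_sorted d s :
  (size s <= d)%N -> sorted (relpre key <=%R) (result (csort_rec key d s)).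
Proof.
elim: d s => [|d IH] [|x [|y s]] //= le_d.
have [_ /= + + _] := csplit_spec [:: x, y & s].
case: (result _) => s1 s2 /= size1 size2.
rewrite result_cmerge merge_sorted // ?IH //; try lia.
by move=> u v; apply: le_total.
Qed.

(** Each split halves the length, so [k] bounds the number of levels. Splitting and merging [N]
    elements costs at most [6 * N + 2]; for [N >= 2], the budget [8 * N] also absorbs the additive
    constants of the two recursive calls. *)
Lemma time_csort_rec d k s :
  (size s <= 2 ^ k)%N -> (time (csort_rec key d s) <= 8 * size s * k + 1)%N.
Proof.
elim: d k s => [|d IH] k s; first by rewrite /=; lia.
case: s => [|x [|y s]]; [by rewrite /=; lia.. |].
case: k => [|k] //; rewrite expnS => le_k.
have [_ + + +] := csplit_spec [:: x, y & s].
have -> : csort_rec key d.+1 [:: x, y & s] =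
   let! (s1, s2) := csplit [:: x, y & s] in
      let! r1 := csort_rec key d s1 in
      let! r2 := csort_rec key d s2 in
      cmerge key r1 r2 by [].
rewrite time_bind; move: (time (csplit _)) => t.
case: (result _) => s1 s2; rewrite [_.1]/= [_.2]/=.
set N := size _ in le_k *; have N2 : (2 <= N)%N by [].
move=> size1 size2 le_split; rewrite !time_bind.
have := time_cmerge (result (csort_rec key d s1)) (result (csort_rec key d s2)).
rewrite !(perm_size (perm_csort_rec _ _)).
have /IH le1 : (size s1 <= 2 ^ k)%N by lia.
have /IH le2 : (size s2 <= 2 ^ k)%N by lia.
have eqN : (size s1 + size s2 = N)%N by lia.
by rewrite -eqN in N2 le_split *; nia.
Qed.

Lemma perm_csort s : perm_eq (result (csort key s)) s.
Proof. exact: perm_csort_rec. Qed.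

Lemma csort_sorted s : sorted (relpre key <=%R) (result (csort key s)).
Proof. exact: csort_rec_sorted. Qed.

Lemma time_csort k s :
  (size s <= 2 ^ k)%N -> (time (csort key s) <= 8 * size s * k + 1)%N.
Proof. exact: time_csort_rec. Qed.

End MergeSort.

(** * The blocks as a partition of the indices *)

Section Blocks.
Variables (R : realType) (n m : nat) (I : instance R n m).

Lemma mem_block i j : (i \in block I j) = (grp I i == j).
Proof. by rewrite mem_enum. Qed.

Lemma block_uniq j : uniq (block I j).
Proof. exact: enum_uniq. Qed.

Lemma sum_block (V : nmodType) (f : 'I_n -> V) :
  \sum_j \sum_(i <- block I j) f i = \sum_i f i.
Proof.
rewrite (partition_big (grp I) predT) //=.
by apply: eq_bigr => j _; rewrite big_enum.
Qed.

Lemma sum_size_block : (\sum_j size (block I j))%N = n.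
Proof.
rewrite -[RHS]card_ord -sum1_card (partition_big (grp I) predT) //=.
by apply: eq_bigr => j _; rewrite -cardE -sum1_card.
Qed.

Lemma size_block_le j : (size (block I j) <= n)%N.
Proof. by rewrite -cardE -[X in (_ <= X)%N]card_ord max_card. Qed.

Lemma leq_blocks : (forall j, exists i, grp I i = j) -> (m <= n)%N.
Proof.
move=> blockP; rewrite -[X in (_ <= X)%N]sum_size_block.
rewrite -[X in (X <= _)%N]card_ord -sum1_card; apply: leq_sum => j _.
have [i /eqP] := blockP j; rewrite -mem_block.
by case: (block I j).
Qed.

End Blocks.

(** * Running times of the subroutines and of the search *)

Section Time.
Variables (R : realType) (n m : nat) (I : instance R n m).

Lemma time_block_sum (f : 'I_n -> R) j :
  (time (block_sum I f j) <= 3 * size (block I j) + 1)%N.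
Proof. exact: time_for_loop_const. Qed.

(** The exponent [k] is taken from [n] and not from the block, so that the logarithmic factor is
    common to all blocks and the bounds add up over them. *)
Lemma time_bp_keys k (f : 'I_n -> R) j (r := bp_keys I f j) :
    (n <= 2 ^ k)%N ->
  size (result r) = size (block I j) /\
  (time r <= size (block I j) * (8 * k + 7) + 2)%N.
Proof.
move=> le_n; rewrite {}/r /bp_keys time_bind (@time_cmap _ _ 6) //.
set s := result (cmap _ _).
have size_s : size s = size (block I j) by rewrite size_cmap.
have le_s : (size s <= 2 ^ k)%N.
  by rewrite size_s (leq_trans _ le_n) // size_block_le.
split; first by rewrite -size_s; apply/perm_size/perm_csort.
apply: leq_trans (leq_add (leqnn _) (time_csort fst le_s)) _.
by rewrite size_s /=; lia.
Qed.

(** Every pass removes one key. Its 42 units are 38 for the step and 4 for the loop test and the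
    comparison of the heads. The nested induction follows the nested fixpoint. *)
Lemma time_bp_loop (l u : 'I_n -> R) j P Q st :
  (time (bp_loop I l u j P Q st) <= 42 * (size P + size Q) + 1)%N.
Proof.
have time_alpha i st' : (time (bp_step_alpha I u j i st') <= 38)%N by case: st'.
have time_beta i st' : (time (bp_step_beta I l j i st') <= 38)%N by case: st'.
have step a b d N : (a <= 38)%N -> (b <= 42 * N + 1)%N -> (d <= 4)%N ->
    (d + (a + b) <= 42 * N.+1 + 1)%N by lia.
elim: P Q st => [|p P IHP]; elim=> [|q Q IHQ] st //=.
- exact: step (time_alpha _ _) (IHQ _) _.
- exact: step (time_beta _ _) (IHP _ _) _.
case: ifP => _ /=; rewrite addnA.
- by rewrite (addnS _ (size Q)); apply: step (time_alpha _ _) (IHQ _) _.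
- by apply: step (time_beta _ _) (IHP _ _) _.
Qed.

Lemma time_breakpoint_procedure k (l u : 'I_n -> R) j ab :
  (n <= 2 ^ k)%N ->
  (time (breakpoint_procedure I l u j ab) <=
     size (block I j) * (16 * k + 101) + 6)%N.
Proof.
move=> le_n; have [sizeP timeP] := time_bp_keys l j le_n.
have [sizeQ timeQ] := time_bp_keys u j le_n.
case: ab => al be.
apply: leq_trans (leq_add timeP (leq_add timeQ (leq_add (time_block_sum u j)
  (leq_add (time_bp_loop _ _ _ _ _ _) (leqnn _))))) _.
by rewrite sizeP sizeQ /=; lia.
Qed.

Lemma time_fixed_free_at p lambda :
  (time (fixed_free_at I p lambda) <= 3 * m + 30 * n + 1)%N.
Proof.
apply: leq_trans (leq_add (leqnn _) (leq_add (leqnn _) (leq_add (leqnn _)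
  (@time_for_loop_ord _ _ 29 _ _ _)))) _; last by rewrite /= card_ord; lia.
by move=> i [Y A B] /=; case: ifP => //= _; case: ifP.
Qed.

Lemma time_compute_x p ff lambda :
  (time (compute_x I p ff lambda) <= 41 * n + 1)%N.
Proof.
case: ff => Y A B.
apply: leq_trans (leq_add (leqnn _) (@time_for_loop_ord _ _ 39 _ _ _)) _.
  by move=> i x /=; case: ifP => //= _; case: ifP.
by rewrite /= card_ord; lia.
Qed.

(** A breakpoint that is passed costs at most 80. The terms in [m] and [n] pay for the single exit:
    [3 * m + 30 * n] to classify the variables at the multiplier, [41 * n] to compute the
    solution. *)
Lemma time_search p bs st :
  (time (search I p bs st) <= 80 * size bs + 3 * m + 71 * n + 20)%N.
Proof.
elim: bs st => [|[eta i is_alpha] bs IH] [F V Y A B]; first by rewrite /=; lia.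
cbn -[addn muln compute_x fixed_free_at].
case: ifP => _; cbn -[addn muln compute_x fixed_free_at].
  by have := time_compute_x p (FixedFree Y A B) eta; lia.
case: ifP => _; cbn -[addn muln compute_x fixed_free_at].
  set lambda := (F - pR I) / V.
  have := time_fixed_free_at p lambda.
  by have := time_compute_x p (result (fixed_free_at I p lambda)) lambda; lia.
by case: is_alpha => /=; set st := SearchState _ _ _ _ _; have := IH st; lia.
Qed.

End Time.

(** * The sorted list of all breakpoints *)

Definition breakpoint_tuple (R : realType) (n : nat) (b : breakpoint R n) :=
  (bp_value b, bp_index b, bp_is_alpha b).

Lemma breakpointK (R : realType) (n : nat) :
  cancel (@breakpoint_tuple R n) (fun t => Breakpoint t.1.1 t.1.2 t.2).
Proof. by case. Qed.

(** Decidable equality makes [perm_eq] and membership available for lists of breakpoints. *)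
HB.instance Definition _ (R : realType) (n : nat) :=
  Equality.copy (breakpoint R n) (can_type (@breakpointK R n)).

Section AllBreakpoints.
Variables (R : realType) (n : nat) (p : prepared R n).

Definition breakpoints_of (i : 'I_n) : seq (breakpoint R n) :=
  [:: Breakpoint (alphas p i) i true; Breakpoint (betas p i) i false].

Definition breakpoint_list := flatten [seq breakpoints_of i | i <- enum 'I_n].

Lemma size_breakpoint_list : size breakpoint_list = (2 * n)%N.
Proof.
rewrite /breakpoint_list -[in RHS](size_enum_ord n).
by elim: (enum 'I_n) => //= i s IH; rewrite IH; lia.
Qed.

(** The collecting loop is abstracted into its output, known up to order, and its cost [t]; what
    remains is a bare call of the sort. *)
Lemma all_breakpointsE : exists2 s,
  perm_eq s breakpoint_list &
  exists2 t, (t <= 5 * n + 1)%N &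
  all_breakpoints p = bind (charge t tt) (fun=> csort (@bp_value R n) s).
Proof.
set body := (fun (i : 'I_n) bs =>
       let! al := rd (alphas p) i in
       let! bs1 := tick (Breakpoint al i true :: bs) in
       let! be := rd (betas p) i in
       tick (Breakpoint be i false :: bs1)).
exists (result (for_loop (enum 'I_n) body [::])).
  (* The empty accumulator is made explicit on the right, so that the induction can generalize
     it. *)
  rewrite /breakpoint_list -[X in perm_eq _ X]cats0.
  elim: (enum 'I_n) (Nil _) => //= i s IH z.
  apply: perm_trans (IH _) _.
  by apply/permP => a; rewrite /= !count_cat /=; lia.
exists (time (for_loop (enum 'I_n) body [::])) => //.
exact: time_for_loop_ord.
Qed.

Lemma perm_all_breakpoints :
  perm_eq (result (all_breakpoints p)) breakpoint_list.
Proof.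
have [s perm_s [t _ ->]] := all_breakpointsE.
by apply: perm_trans perm_s; apply: perm_csort.
Qed.

Lemma all_breakpoints_sorted :
  sorted (relpre (@bp_value R n) <=%R) (result (all_breakpoints p)).
Proof. by have [s _ [t _ ->]] := all_breakpointsE; apply: csort_sorted. Qed.

Lemma time_all_breakpoints k :
  (0 < n)%N -> (n <= 2 ^ k)%N ->
  (time (all_breakpoints p) <= n * (16 * k + 23))%N.
Proof.
move=> n0 le_n; have [s perm_s [t le_t ->]] := all_breakpointsE.
(* There are [2 * n] breakpoints, hence one more level of sorting. *)
have le_s : (size s <= 2 ^ k.+1)%N.
  by rewrite (perm_size perm_s) size_breakpoint_list expnS; lia.
apply: leq_trans (leq_add le_t (time_csort _ le_s)) _.
by rewrite (perm_size perm_s) size_breakpoint_list; nia.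
Qed.

End AllBreakpoints.

(** The constant is a parameter, so that one [c] serves all subproblems of all instances. *)
Definition solver_time_le (R : realType) (solve : qrap_solver R) (c : nat) :
    Prop :=
  forall (n : nat) (s : seq 'I_n) (a b l u : 'I_n -> R) (S : R),
    uniq s -> (forall i, i \in s -> 0 < a i) ->
    (exists x, qrap_feasible s l u S x) ->
    (time (solve n s a b l u S) <= c * (size s).+1)%N.

(** * Replacement of the bounds and computation of the breakpoints *)

Section Preparation.
Variables (R : realType) (solve : qrap_solver R) (c : nat).
Hypothesis solve_correct : qrap_solver_correct solve.
Hypothesis solve_linear : solver_time_le solve c.
Variables (n m : nat) (I : instance R n m).
Hypothesis a_gt0 : forall i, 0 < pa I i.

(** The solution for [pL I j] is feasible, so it dominates [l] on the block and the maximum is that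
    solution itself. The new lower bounds therefore inherit its sum [pL I j]. *)
Lemma replace_bounds_spec j l u (r := replace_bounds solve I j (l, u)) :
    (exists x, qrap_feasible (block I j) l u (pL I j) x) ->
    (exists x, qrap_feasible (block I j) l u (pU I j) x) ->
  [/\ forall i, i \notin block I j ->
        (result r).1 i = l i /\ (result r).2 i = u i,
      \sum_(i <- block I j) (result r).1 i = pL I j
    & (time r <= (2 * c + 9) * (size (block I j)).+1)%N].
Proof.
move=> feasL feasU; rewrite {}/r.
pose xlow := result (solve (block I j) (pa I) (pb I) l u (pL I j)).
pose xupp := result (solve (block I j) (pa I) (pb I) l u (pU I j)).
have [[sum_low low_bounds] _] :
    qrap_optimal (block I j) (pa I) (pb I) l u (pL I j) xlow.
  by apply: solve_correct => //; apply: block_uniq.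
have timeL := solve_linear (pb I) (block_uniq I j) (fun i _ => a_gt0 i) feasL.
have timeU := solve_linear (pb I) (block_uniq I j) (fun i _ => a_gt0 i) feasU.
(* [t] holds the indices not yet treated; lower bounds have become [xlow] exactly on the rest of the
   block. *)
pose Inv (t : seq 'I_n) (lu : ('I_n -> R) * ('I_n -> R)) :=
  [/\ uniq t, {subset t <= block I j},
      forall i,
        lu.1 i = if (i \in block I j) && (i \notin t) then xlow i else l i
    & forall i, i \notin block I j -> lu.2 i = u i].
have := @for_loop_inv _ _ Inv (fun=> 8) (fun i '(l, u) =>
       let! l' := wr l i (cmax (rd l i) (rd xlow i)) in
       let! u' := wr u i (cmin (rd u i) (rd xupp i)) in
       ret (l', u')) (block I j) (l, u).
case.
- move=> i t [l1 u1] [/= /andP[it uniq_t] sub lE uE]; split=> //; split=> //=.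
  + by move=> i' i't; apply: sub; rewrite inE i't orbT.
  + move=> i'; have ij : i \in block I j by apply: sub; rewrite mem_head.
    have [->|i'i] := eqVneq i' i.
      rewrite ij it lE inE eqxx andbF; apply/max_idPr.
      by case/andP: (low_bounds i ij).
    by rewrite lE inE (negPf i'i).
  + move=> i' i'j; case: eqP => [ii'|_]; last exact: uE.
    by rewrite ii' sub ?mem_head in i'j.
- split=> //= [|i]; first exact: block_uniq.
  by rewrite andbN.
move=> [_ _ lE uE] le_t; split.
- by move=> i ij; split; [rewrite lE (negPf ij) | apply: uE].
- by rewrite -[RHS]sum_low; apply: eq_big_seq => i ij; rewrite lE ij.
apply: leq_trans (leq_add (leqnn _) (leq_add timeL
  (leq_add (leqnn _) (leq_add timeU le_t)))) _.
rewrite big_const_seq count_predT iter_addn_0 /=; lia.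
Qed.

(* The time bound of the solver only applies to feasible subproblems, so the
   invariant records that the bounds of the blocks still to come are original. *)
Lemma preparation_spec k (r := preparation solve I) :
    admissible I -> (n <= 2 ^ k)%N ->
  (forall j, \sum_(i <- block I j) new_l (result r) i = pL I j) /\
  (time r <= 2 * n + (2 * c + 16 * k + 117) * (n + m) + 1)%N.
Proof.
move=> [_ _ _ _ feasL feasU] le_n.
pose Inv (t : seq 'I_m) (p : prepared R n) :=
  [/\ uniq t,
      forall i, grp I i \in t -> new_l p i = pl I i /\ new_u p i = pu I i
    & forall j, j \notin t -> \sum_(i <- block I j) new_l p i = pL I j].
pose cost_block j := ((2 * c + 16 * k + 116) * (size (block I j)).+1)%N.
have := @for_loop_inv _ _ Inv cost_block (fun j '(Prepared l u al be) =>
       let! (l', u') := replace_bounds solve I j (l, u) in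
       let! (al', be') := breakpoint_procedure I l' u' j (al, be) in
       ret (Prepared l' u' al' be')) (enum 'I_m)
   (Prepared (pl I) (pu I) (fun=> 0) (fun=> 0)).
case.
- move=> j t [l u al be] [uniq_jt luE sumE].
  have /andP[jt uniq_t] := uniq_jt; rewrite /= in luE sumE.
  have feasible_block S :
      (exists x, qrap_feasible (block I j) (pl I) (pu I) S x) ->
      exists x, qrap_feasible (block I j) l u S x.
    move=> [x [sum_x x_bounds]]; exists x; split=> // i ij.
    have [|-> ->] := luE i; last exact: x_bounds.
    by rewrite mem_block in ij; rewrite inE ij.
  have [out sum_j] := replace_bounds_spec (feasible_block _ (feasL j))
    (feasible_block _ (feasU j)).
  lazy beta iota.
  case: (replace_bounds _ _ _ _) out sum_j => [[l' u'] t1] out sum_j le_t1.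
  rewrite /= in out sum_j le_t1; cbn -[addn muln breakpoint_procedure].
  have le_t2 := time_breakpoint_procedure I l' u' j (al, be) le_n.
  case: (breakpoint_procedure _ _ _ _ _) le_t2 => [[al' be'] t2] le_t2.
  rewrite /= in le_t2 *.
  split; last by rewrite /cost_block; lia.
  split=> //= [i it | j' j't].
    have ij : i \notin block I j.
      by rewrite mem_block; apply: contraNneq jt => <-.
    by have [-> ->] := out i ij; apply: luE; rewrite inE it orbT.
  (* A block treated earlier is disjoint from block [j], so its bounds are left alone. *)
  have [->//|j'j] := eqVneq j' j.
  rewrite -[RHS]sumE ?inE ?negb_or ?j'j //; apply: eq_big_seq => i ij'.
  apply: proj1 (out i _); rewrite mem_block in ij'; rewrite mem_block.
  by rewrite (eqP ij').
- by split=> //= [|j]; [apply: enum_uniq | rewrite mem_enum].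
move=> [_ _ sumE] le_t; split; first by move=> j; apply: sumE.
apply: leq_trans (leq_add (leqnn _) (leq_add (leqnn _) le_t)) _.
rewrite /= card_ord big_enum /= /cost_block.
(* Summing [(size (block I j)).+1] over the blocks gives [n + m]. *)
under eq_bigr do rewrite -addn1 mulnS.
rewrite !big_split /= -big_distrr /= sum_size_block !sum_nat_const card_ord.
by lia.
Qed.

End Preparation.

(** * Total running time in terms of a bound [2 ^ k] on [n] *)

Lemma time_sequential_algorithm (R : realType) (solve : qrap_solver R) (c : nat)
    (n m : nat) (I : instance R n m) (k : nat) :
    qrap_solver_correct solve -> solver_time_le solve c -> admissible I ->
    (0 < n)%N -> (n <= 2 ^ k)%N ->
  (time (sequential_algorithm solve I) <= n * (4 * c + 48 * k + 530))%N.
Proof.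
move=> correct linear adm n0 le_n.
have le_mn := leq_blocks (adm_block adm).
have [_ time_prep] := preparation_spec correct linear (adm_a adm) adm le_n.
have time_Y p Y0 : (time (for_loop (enum 'I_m)
    (fun j Y => wr Y j (block_sum I (new_u p) j)) Y0) <= 3 * n + 3 * m + 1)%N.
  apply: leq_trans
    (time_for_loop_le _ _ (c := fun j => (3 * size (block I j) + 2)%N) _) _.
    by move=> j Y /=; have := time_block_sum I (new_u p) j; lia.
  rewrite big_enum /=; under eq_bigr do rewrite /= -addn1 -addnA.
  rewrite big_split -big_distrr /= sum_size_block sum_nat_const card_ord.
  by lia.
apply: leq_trans (leq_add time_prep (leq_add (time_all_breakpoints _ n0 le_n)
  (leq_add (@time_for_loop_ord _ _ 2 _ _ _) (leq_add (leqnn _)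
  (leq_add (leqnn _) (leq_add (leqnn _)
  (leq_add (time_Y _ _) (time_search _ _ _ _)))))))) _ => //.
(* By [m <= n], sorting the keys contributes at most [32 * k] per index and sorting the breakpoints
   [16 * k]; [0 < n] absorbs the additive constants. *)
rewrite (perm_size (perm_all_breakpoints _)) size_breakpoint_list /= card_ord.
by nia.
Qed.

(** * The search finds a multiplier *)

Section Search.
Variables (R : realType) (n m : nat) (I : instance R n m) (p : prepared R n).
Implicit Types (b : breakpoint R n) (bs : seq (breakpoint R n)).

(* The change of a running sum when the breakpoint [b] is passed. *)
Definition increment (alpha_inc beta_inc : 'I_n -> R) b : R :=
  if bp_is_alpha b then alpha_inc (bp_index b) else beta_inc (bp_index b).

Definition total_change bs (alpha_inc beta_inc : 'I_n -> R) (j : 'I_m) : R :=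
  \sum_(b <- bs | grp I (bp_index b) == j) increment alpha_inc beta_inc b.

(** [bs] lists the breakpoints already passed. The running sums get closed forms that do not depend
    on the order of [bs], so they can be evaluated on a permutation of it. *)
Record search_invariant bs (st : search_state R m) : Prop := SearchInvariant {
  inv_Y : forall j, ss_Y st j =
    \sum_(i <- block I j) new_u p i
      + total_change bs (fun i => - new_u p i) (new_l p) j;
  inv_A : forall j, ss_A st j =
    total_change bs (fun i => 1 / pa I i) (fun i => - (1 / pa I i)) j;
  inv_B : forall j, ss_B st j =
    total_change bs (fun i => pb I i / pa I i) (fun i => - (pb I i / pa I i)) j;
  inv_F : ss_F st =
    \sum_j (ss_Y st j - ss_B st j) / (1 + pw I j * ss_A st j);
  inv_V : ss_V st = \sum_j ss_A st j / (1 + pw I j * ss_A st j) }.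

Lemma total_change_rcons bs b f g j :
  total_change (rcons bs b) f g j = if j == grp I (bp_index b)
    then total_change bs f g j + increment f g b else total_change bs f g j.
Proof.
rewrite /total_change -cats1 big_cat big_cons big_nil /= [j == _]eq_sym.
by case: eqP => // _; rewrite addr0.
Qed.

(** This is why [F] and [V] stay sums over all blocks: the loop replaces the term of the one block
    that changes. *)
Lemma sum_update (f f' : 'I_m -> R) j :
  (forall i, i != j -> f' i = f i) ->
  \sum_i f' i = \sum_i f i - f j + f' j.
Proof.
move=> ff'; rewrite (bigD1 j) //= (eq_bigr _ ff') [in RHS](bigD1 j) //=.
by ring.
Qed.

(** A run without an outcome reaches the last breakpoint [b] and fails both tests there, so the
    computed total strictly exceeds [pR I]. The state at that moment accounts for everything before
    [b]. *)
Lemma search_None bs bs' b st :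
    search_invariant bs st ->
    result (search I p (rcons bs' b) st) = None ->
  exists2 st', search_invariant (bs ++ bs') st' &
    pR I < ss_F st' - ss_V st' * bp_value b.
Proof.
elim: bs' bs st => [|[eta k is_alpha] bs' IH] bs [F V Y A B] inv.
  rewrite cats0; case: b => eta k is_alpha /=.
  case: eqP => //= /eqP neq; case: ltP => //= le _.
  by exists (SearchState F V Y A B) => //=; rewrite lt_neqAle eq_sym neq.
(* The head moves from the remaining breakpoints to those already passed. *)
rewrite -cat_rcons; case: inv => /= YE AE BE FE VE.
case: eqP => //= _; case: ltP => //= _.
set F1 := F - _; set V1 := V - _.
case: is_alpha => /=; (set st := SearchState _ _ _ _ _) => none;
  apply: IH none; split=> [j|j|j||] /=;
  do ?[by rewrite total_change_rcons ?(YE, AE, BE) /=; case: eqP => [->|] //;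
       rewrite ?addrA];
  rewrite ?/F1 ?/V1 ?FE ?VE; apply/esym;
  apply: (sum_update (f := fun j => _ / (1 + pw I j * A j))) => i /negPf ik;
  by rewrite ik.
Qed.

(** The last element is maximal, and no [alphas p k] can be maximal because [betas p k] is
    larger. *)
Lemma last_breakpoint bs :
    (0 < n)%N -> (forall i, alphas p i < betas p i) ->
    perm_eq bs (breakpoint_list p) -> sorted (relpre (@bp_value R n) <=%R) bs ->
  exists bs' k, bs = rcons bs' (Breakpoint (betas p k) k false) /\
    forall i, betas p i <= betas p k.
Proof.
move=> n_gt0 lt_ab perm_bs; case/lastP: bs perm_bs => [|bs b] perm_bs.
  by have := perm_size perm_bs; rewrite size_breakpoint_list /=; lia.
rewrite sorted_pairwise; last by move=> x y z; apply: le_trans.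
rewrite -cats1 pairwise_cat => /andP[/allrelP le_b _].
have le_value b' : b' \in breakpoint_list p -> bp_value b' <= bp_value b.
  rewrite -(perm_mem perm_bs) mem_rcons inE => /predU1P[-> //|b'bs].
  by apply: le_b => //; apply: mem_head.
have mem_list i b' : b' \in breakpoints_of p i -> b' \in breakpoint_list p.
  by move=> b'i; apply/flatten_mapP; exists i; rewrite ?mem_enum.
have le_beta i : betas p i <= bp_value b.
  apply: (le_value (Breakpoint (betas p i) i false)); apply: (mem_list i).
  by rewrite !inE eqxx orbT.
have : b \in breakpoint_list p.
  by rewrite -(perm_mem perm_bs) mem_rcons mem_head.
case/flatten_mapP => k _; rewrite !inE => /orP[] /eqP b_def.
  by have := lt_le_trans (lt_ab k) (le_beta k); rewrite b_def /= ltxx.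
exists bs, k; rewrite cats1 -b_def; split=> // i.
by rewrite (le_trans (le_beta i)) ?b_def.
Qed.

(** Over the complete list each index contributes both of its increments; only the lower-bound
    increment of [k] is missing. *)
Lemma total_change_all_but_last bs k f g j :
  perm_eq (rcons bs (Breakpoint (betas p k) k false)) (breakpoint_list p) ->
  total_change bs f g j =
    \sum_(i <- block I j) (f i + g i) - (if j == grp I k then g k else 0).
Proof.
move=> perm_bs.
have : total_change (rcons bs (Breakpoint (betas p k) k false)) f g j =
    \sum_(i <- block I j) (f i + g i).
  rewrite /total_change (perm_big _ perm_bs) big_flatten big_map big_enum /=.
  rewrite [RHS]big_enum /=.
  rewrite [RHS]big_mkcond; apply: eq_bigr => i _.
  rewrite /breakpoints_of !big_cons big_nil inE /=.
  by case: eqP => _; rewrite ?addr0.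
by rewrite total_change_rcons /increment => <- /=; case: ifP => _; ring.
Qed.

(** Provides a positive denominator when [k] is the only free variable of its block. If the weight
    is negative, one reciprocal lowers the value by less than the whole sum does. *)
Lemma convex_block j k :
  admissible I -> grp I k = j -> 0 < 1 + pw I j * (pa I k)^-1.
Proof.
move=> adm kj; have a0 i : 0 < (pa I i)^-1 by rewrite invr_gt0 (adm_a adm).
have [w0|w0] := leP 0 (pw I j).
  by rewrite ltr_wpDr // mulr_ge0 // ltW.
apply: lt_le_trans (adm_convex adm j) _; rewrite lerD2l ler_wnM2l ?(ltW w0) //.
rewrite big_enum /= (bigD1 k) /=; last by rewrite inE kj.
by rewrite lerDl sumr_ge0 // => i _; apply: ltW.
Qed.

Lemma sum_lower_bounds : admissible I -> \sum_j pL I j <= pR I.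
Proof.
move=> [_ _ _ [x [<- x_blocks _]] _ _].
by rewrite -(sum_block I x) ler_sum // => j _; case/andP: (x_blocks j).
Qed.

(* After clearing denominators and substituting the stationarity condition of
   [k] for [pb I k], the only term left is [- mu_k / a_k >= 0]. *)
Lemma total_at_last_breakpoint bs k st :
    admissible I ->
    (forall j, \sum_(i <- block I j) new_l p i = pL I j) ->
    are_breakpoints I (new_l p) (new_u p) (alphas p) (betas p) ->
    perm_eq (rcons bs (Breakpoint (betas p k) k false)) (breakpoint_list p) ->
    (forall i, betas p i <= betas p k) ->
    search_invariant bs st ->
  ss_F st - ss_V st * betas p k <= pR I.
Proof.
move=> adm sum_l [x [mu [xmu bpP]]] perm_bs le_beta inv.
have accE f g j := total_change_all_but_last f g j perm_bs.
set eta := betas p k; have x_low i : x eta i = new_l p i.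
  by have [_ /(_ eta)[_ _ [+ _]]] := bpP i; apply; apply: le_beta.
have [stationary _ mu_u _] := xmu eta k.
(* At the midpoint of the two breakpoints of [k], the variable lies strictly between its bounds. *)
have lt_lu : new_l p k < new_u p k.
  have [lt_ab /(_ ((alphas p k + eta) / 2))[_ [+ _] _]] := bpP k.
  by rewrite !(midf_lt lt_ab) => /(_ isT)/andP[]; apply: lt_trans.
have mu_le0 : mu eta k <= 0.
  move/eqP: mu_u; rewrite mulf_eq0 x_low subr_eq0 (lt_eqF lt_lu) orbF.
  by move/eqP=> mu0; rewrite -mu0 le_max lexx orbT.
apply: le_trans (sum_lower_bounds adm).
(* It suffices that the term of each block [j] is at most [pL I j]. *)
rewrite (inv_F inv) (inv_V inv) mulr_suml -sumrB; apply: ler_sum => j _.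
rewrite (inv_Y inv) (inv_A inv) (inv_B inv) !accE.
have sum_diff0 (f : 'I_n -> R) : \sum_(i <- block I j) (f i - f i) = 0.
  by apply: big1 => i _; rewrite subrr.
rewrite (sum_diff0 (fun i => 1 / pa I i)).
rewrite (sum_diff0 (fun i => pb I i / pa I i)).
rewrite big_split /= sumrN sum_l.
(* In a block without [k] all variables have reached their lower bounds: [A] and [B] vanish, the
   denominator is 1 and the term equals [pL I j]. *)
set U := \sum_(i <- _) _; have [jk|_] := eqVneq j (grp I k); last first.
  by rewrite !subr0 mulr0 addr0 divr1 !mul0r subr0; lra.
rewrite -jk (eq_bigr _ (fun i _ => x_low i)) sum_l in stationary.
have a_gt0 := adm_a adm k; have a_neq0 : pa I k != 0 by rewrite gt_eqF.
have d_gt0 := convex_block adm (esym jk).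
have lam : pb I k = - (pw I j * pL I j + pa I k * new_l p k + eta + mu eta k).
  by move: stationary; rewrite x_low => /eqP; rewrite -!addrA; lra.
(* In the block of [k] the sum [A] is [1 / pa I k], so the denominator is the positive [d_gt0]. *)
rewrite -mulrA [_^-1 * _]mulrC mulrA -mulrBl ler_pdivrMr; last first.
  by rewrite sub0r opprK mul1r.
rewrite lam -subr_ge0.
have -> : pL I j * (1 + pw I j * (0 - - (1 / pa I k))) -
  (U + (- U + pL I j - new_l p k) -
   (0 - - (- (pw I j * pL I j + pa I k * new_l p k + eta + mu eta k)
             / pa I k)) -
   (0 - - (1 / pa I k)) * eta) = - mu eta k / pa I k by field.
by rewrite divr_ge0 // ?oppr_ge0 // ltW.
Qed.

Lemma search_found bs st :
    (0 < n)%N -> admissible I ->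
    (forall j, \sum_(i <- block I j) new_l p i = pL I j) ->
    are_breakpoints I (new_l p) (new_u p) (alphas p) (betas p) ->
    perm_eq bs (breakpoint_list p) -> sorted (relpre (@bp_value R n) <=%R) bs ->
    search_invariant [::] st ->
  result (search I p bs st) <> None.
Proof.
move=> n_gt0 adm sum_l bpP perm_bs sorted_bs inv none.
have lt_ab i : alphas p i < betas p i.
  by have [x [mu [_ /(_ i)[]]]] := bpP.
have [bs' [k [bsE le_beta]]] := last_breakpoint n_gt0 lt_ab perm_bs sorted_bs.
rewrite bsE in none perm_bs; have [st' inv'] := search_None inv none.
by rewrite ltNge (total_at_last_breakpoint adm sum_l bpP perm_bs le_beta inv').
Qed.

End Search.

(** * The initial state of the search *)

Lemma result_sum_loop (R : realType) (T : finType) (s : seq T) (f : T -> R) z :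
  result (for_loop s (fun i v => (ret v + rd f i)%cost) z) =
    z + \sum_(i <- s) f i.
Proof.
elim: s z => [|x s IH] z /=; first by rewrite big_nil addr0.
by rewrite IH big_cons addrA.
Qed.

Lemma result_array_loop (T : finType) (S : Type) (s : seq T) (f : T -> cost S)
    (z : T -> S) i :
  result (for_loop s (fun i g => wr g i (f i)) z) i =
    if i \in s then result (f i) else z i.
Proof.
elim: s z => [|x s IH] z //=; rewrite IH inE.
by case: eqP => [->|]; case: ifP.
Qed.

Lemma initial_invariant (R : realType) (n m : nat) (I : instance R n m)
    (p : prepared R n) :
  search_invariant I p [::] (SearchState
    (result (for_loop (enum 'I_n)
       (fun i s => (ret s + rd (new_u p) i)%cost) 0)) 0
    (result (for_loop (enum 'I_m)
       (fun j Y => wr Y j (block_sum I (new_u p) j)) (fun=> 0)))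
    (fun=> 0) (fun=> 0)).
Proof.
have acc0 f g j : total_change I [::] f g j = 0 by rewrite /total_change big_nil.
have YE j : result (for_loop (enum 'I_m)
    (fun j Y => wr Y j (block_sum I (new_u p) j)) (fun=> 0)) j =
    \sum_(i <- block I j) new_u p i.
  by rewrite result_array_loop mem_enum result_sum_loop add0r.
split=> [j|j|j||]; rewrite ?acc0 //= ?YE ?addr0 //.
  rewrite result_sum_loop add0r big_enum -(sum_block I); apply: eq_bigr => j _.
  by rewrite YE subr0 mulr0 addr0 divr1.
by rewrite big1 // => j _; rewrite mul0r.
Qed.

(** * Passage to the natural logarithm and conclusion *)

Lemma trunc_log_le_ln (R : realType) (n : nat) :
  (0 < n)%N -> (trunc_log 2 n)%:R * ln 2 <= ln n%:R :> R.
Proof.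
move=> n_gt0; rewrite mulr_natl -lnXn // ler_ln ?posrE ?exprn_gt0 ?ltr0n //.
by rewrite -natrX ler_nat trunc_logP.
Qed.

Theorem theorem1 (R : realType) (solve : qrap_solver R)
    (solve_correct : qrap_solver_correct solve)
    (solve_linear : qrap_solver_linear_time solve) :
  (exists (C : R) (n0 : nat),
     forall (n m : nat) (I : instance R n m),
       (n0 <= n)%N -> admissible I ->
       (time (sequential_algorithm solve I))%:R <= C * (n%:R * ln n%:R))
  /\
  (forall (n m : nat) (I : instance R n m),
     (0 < n)%N -> admissible I ->
     are_breakpoints I
       (new_l (result (preparation solve I)))
       (new_u (result (preparation solve I)))
       (alphas (result (preparation solve I)))
       (betas (result (preparation solve I))) ->
     result (sequential_algorithm solve I) <> None).
Proof.
have [c linear] := solve_linear; split.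
  (* With [k = t.+1] the bound is [n * (4 * c + 48 * t + 578)]; [n >= 2] gives [t >= 1], and
     [48 + 578 = 626]. Dividing by [ln 2] changes the base of the logarithm. *)
  exists ((4 * c + 626)%:R / ln 2), 2%N => n m I n2 adm.
  have n_gt0 : (0 < n)%N by lia.
  have ln2 : 0 < ln 2 :> R by rewrite ln_gt0 // ltr1n.
  set t := trunc_log 2 n; have t_gt0 : (0 < t)%N by rewrite trunc_log_gt0.
  have le_n : (n <= 2 ^ t.+1)%N by rewrite ltnW // trunc_log_ltn.
  have le_time := time_sequential_algorithm solve_correct linear adm n_gt0 le_n.
  apply: (@le_trans _ _ ((4 * c + 626) * (n * t))%:R).
    by rewrite ler_nat; apply: leq_trans le_time _; nia.
  rewrite mulrAC ler_pdivlMr // !natrM -!mulrA ler_wpM2l ?ler_wpM2l //.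
  exact: trunc_log_le_ln.
move=> n m I n_gt0 adm bpP.
(* Only the sums of the lower bounds matter here, so the crude exponent [k = n] suffices. *)
have [sum_l _] := preparation_spec solve_correct linear (adm_a adm) adm
  (ltnW (ltn_expl n (leqnn 2))).
apply: (search_found n_gt0 adm sum_l bpP).
- exact: perm_all_breakpoints.
- exact: all_breakpoints_sorted.
- exact: initial_invariant.
Qed.
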